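(* Let $G=(V,E)$ be a network with $n$ nodes, with distances $d$ and service demand $w$, whose topology is a tree, and let $k<n$ be a positive integer. Let $\hat{S}^0,\hat{S}^1,\hat{S}^2,\dots$ be the sets of $k$ nodes produced by the distributed Lloyd's method (DLM) on $(G,w,k)$. Then: (i) For each iteration of DLM, the overall weighted cost does not increase, i.e. $$\mathrm{cost}(\hat{S}^{t+1}\mid G)\le \mathrm{cost}(\hat{S}^{t}\mid G)\quad\text{for } t=1,2,\dots.$$ (ii) DLM converges in a finite number of iterations even if the maximum number of iterations MaxIter is set to infinity; that is, after finitely many iterations its stopping criterion $\max_{1\le i\le k} d(\hat{s}_i^t,\hat{s}_i^{t-1})\le\eta$ is met.
   Context: Setting. $G=(V,E)$ is a graph with $|V|=n$. Each node $v$ has a non-negative weight $w(v)$ (its service demand). Each edge $(u,v)\in E$ has a non-negative distance $d(u,v)$. For distinct nodes $u,v$, $\rho(u,v)$ is the shortest path from $u$ to $v$ and $d(u,v)=\sum_{(i,j)\in\rho(u,v)}d(i,j)$ is its distance. The value $d(v,v)\ge 0$ is also given and is allowed to be nonzero (a local cost of choosing $v$ as a data center). $\mathcal N(v)$ is the set of neighbors of $v$. For $S\subset V$, each node $v$ is served by $s(v;S)\in\arg\min_{s\in S}d(s,v)$, and $\mathrm{cost}(S\mid G)=\sum_{v\in V}w(v)d(s(v;S),v)$. Distributed Voronoi partitioning. Given generators $S=\{s_1,\dots,s_k\}$, start with $V_i=\{s_i\}$. For each $v\in V\setminus S$ let $\underline d(v)=\min_{1\le i\le k}d(s_i,v)$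 and $I(v)=\{i: d(s_i,v)=\underline d(v)\}$. If $I(v)=\{i\}$ is a singleton, add $v$ to $V_i$. Otherwise choose $u$ uniformly at random from $U=\{u\in\mathcal N(v): (v,u)\in\rho(v,s_i)\text{ for some } i\in I(v)\}$ and add $v$ to the same region as $u$. The output is the partition $\{V_i\}_{i=1}^k$ of $V$. DLM (distributed Lloyd's method). Input: $G$, $w$, $k<n$, a fixed small $\eta>0$, and a bound MaxIter. Initialization: select an initial set of $k$ nodes $\hat S^0=\{\hat s_i^0\}_{i=1}^k$. For $t=1,2,\dots$ up to MaxIter: 1. Construct the partition $\{V_i^t\}_{i=1}^k$ of $G$ corresponding to the generators $\hat S^{t-1}$ by the distributed Voronoi partitioning above. 2. For each $i=1,\dots,k$, construct a minimum spanning tree $T_i^t$ of the region $V_i^t$, compute for every $s\in V_i^t$ the cost $\mathrm{cost}(s\mid T_i^t)=\sum_{v\in V_i^t}w(v)d(s,v)$, where distances between distinct nodes are measured along $T_i^t$ (this is done by a message-passing procedure on $T_i^t$ rooted at $\hat s_i^{t-1}$ that computes these values exactly), and set $\hat s_i^t\in\arg\min_{s\in V_i^t}\mathrm{cost}(s\mid T_i^t)$. 3. Set $\hat S^t=\{\hat s_i^t\}_{i=1}^k$. Stop if $\max_{1\le i\le k}d(\hat s_i^t,\hat s_i^{t-1})\le\eta$. The algorithm returns the last $\hat S^t$.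
   Formalization: In (i), each node of Ŝ^t is assumed to be a nearest node of Ŝ^t to itself (automatic if d(v,v)=0). In the stopping criterion an unmoved center has distance 0. In (ii), a center already minimizing is kept or replaced by one preceding it in a fixed strict partial order. *)

(* Defs.v *)
From HB Require Import structures.
From mathcomp Require Import all_boot all_order all_algebra.

Set Implicit Arguments.
Unset Strict Implicit.
Unset Printing Implicit Defensive.

Import Order.TTheory GRing.Theory Num.Theory.
Local Open Scope ring_scope.

Record network (R : realFieldType) (V : finType) := Network {
  edge : rel V;
  edge_sym : symmetric edge;
  edge_irr : irreflexive edge;
  len : V -> V -> R;
  len_sym : forall u v, edge u v -> len u v = len v u;
  len_ge0 : forall u v, edge u v -> 0 <= len u v;
  loc : V -> R;  (* loc v is the local cost d(v,v) *)
  loc_ge0 : forall v, 0 <= loc v;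
  demand : V -> R;
  demand_ge0 : forall v, 0 <= demand v
}.

(* T is (the adjacency relation of) a tree with vertex set A.  For a symmetric
   irreflexive T, the duplicate-free T-cycles of size at most 2 are a single
   edge traversed back and forth, or empty. *)
Definition is_tree (V : finType) (A : {set V}) (T : rel V) : Prop :=
  [/\ symmetric T /\ irreflexive T,
      A != set0 /\ (forall u v, T u v -> (u \in A) && (v \in A)),
      {in A &, forall u v, connect T u v}
    & forall c : seq V, ucycle T c -> (size c <= 2)%N].

Section Network.

Variables (R : realFieldType) (V : finType) (G : network R V).

(* A path from u is given by its vertices after u. *)
Definition path_edges (u : V) (p : seq V) : seq (V * V) := zip (u :: p) p.

Definition path_len (u : V) (p : seq V) : R :=
  \sum_(x <- path_edges u p) len G x.1 x.2.

(* A simple path from u to v in T of minimal length; [::] if there is none. *)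
Definition rho (T : rel V) (u v : V) : seq V :=
  [arg min_(p < ([bseq] : {bseq #|V| of V}) |
            [&& path T u p, last u p == v & uniq (u :: p)]) path_len u p]%O.

(* Path length alone: path_dist T v v = 0. *)
Definition path_dist (T : rel V) (u v : V) : R := path_len u (rho T u v).

(* The distance d along T, with d(v,v) = loc v. *)
Definition dist_in (T : rel V) (u v : V) : R :=
  if u == v then loc G v else path_dist T u v.

Definition dist : V -> V -> R := dist_in (edge G).

(* The junk value v is used only for S = set0. *)
Definition server (S : {set V}) (v : V) : V :=
  [arg min_(s < v in S) dist s v]%O.

Definition cost (S : {set V}) : R := \sum_v demand G v * dist (server S v) v.

(* Every node of S is a nearest node of S for its own demand, so that server S
   can serve it locally. *)
Definition serves_itself (S : {set V}) : Prop :=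
  {in S &, forall s s', dist s s <= dist s' s}.

(* Each edge of the symmetric relation T is counted twice, which does not
   affect the comparison of weights. *)
Definition weight (T : rel V) : R := \sum_u \sum_(v | T u v) len G u v.

Definition spanning_tree (A : {set V}) (T : rel V) : Prop :=
  is_tree A T /\ subrel T (edge G).

Definition minimum_spanning_tree (A : {set V}) (T : rel V) : Prop :=
  spanning_tree A T /\
  forall T' : rel V, spanning_tree A T' -> weight T <= weight T'.

Definition tree_cost (A : {set V}) (T : rel V) (s : V) : R :=
  \sum_(v in A) demand G v * dist_in T s v.

Definition minimizers (A : {set V}) (T : rel V) : {set V} :=
  [set s in A | [forall x in A, tree_cost A T s <= tree_cost A T x]].

Section Voronoi.

Variables (k : nat) (s : 'I_k -> V).

Definition nearest (v : V) : {set 'I_k} :=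
  [set i | [forall j, dist (s i) v <= dist (s j) v]].

Definition tie_neighbors (v : V) : {set V} :=
  [set u | edge G v u &
           [exists i in nearest v,
              (v, u) \in path_edges v (rho (edge G) v (s i))]].

(* A partition into regions is given by the map r sending a node to the index
   of its region.  [added r v] says that some execution of the procedure that
   produces r adds v: a tied node joins the region of a node of tie_neighbors
   that has itself been added before.  Every element of tie_neighbors is a
   possible outcome of the uniform draw. *)
Inductive added (r : V -> 'I_k) : V -> Prop :=
| added_generator i : r (s i) = i -> added r (s i)
| added_nearest v :
    v \notin codom s -> nearest v = [set r v] -> added r v
| added_tie v u :
    v \notin codom s -> #|nearest v| != 1%N -> u \in tie_neighbors v ->
    added r u -> r v = r u -> added r v.

Definition voronoi (r : V -> 'I_k) : Prop := forall v, added r v.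

End Voronoi.

Definition region (k : nat) (r : V -> 'I_k) (i : 'I_k) : {set V} :=
  [set v | r v == i].

Section DLM.

Variables (k : nat) (eta : R) (maxiter : option nat).

(* [dlm_step s r T s'] is one iteration from the centers s to the centers s',
   with regions r and spanning trees T. *)
Definition dlm_step (s : 'I_k -> V) (r : V -> 'I_k) (T : 'I_k -> rel V)
    (s' : 'I_k -> V) : Prop :=
  [/\ voronoi s r,
      forall i, minimum_spanning_tree (region r i) (T i)
    & forall i, s' i \in minimizers (region r i) (T i)].

(* The distance is the displacement of a center: a center that stays in place
   has moved by 0, whatever its local cost. *)
Definition stopped (s s' : 'I_k -> V) : bool :=
  [forall i, path_dist (edge G) (s' i) (s i) <= eta].

(* None stands for an infinite maximum number of iterations. *)
Definition within_maxiter (t : nat) : bool :=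
  if maxiter is Some m then (t < m)%N else true.

(* Iteration t.+1, leading from s t to s t.+1, is performed. *)
Definition performed (s : nat -> 'I_k -> V) (t : nat) : bool :=
  within_maxiter t && [forall u : 'I_t, ~~ stopped (s u) (s u.+1)].

(* Regions and trees are indexed by the iteration that constructs them; values
   after the last iteration performed are unconstrained. *)
Definition dlm_run (s : nat -> 'I_k -> V) (r : nat -> V -> 'I_k)
    (T : nat -> 'I_k -> rel V) : Prop :=
  injective (s 0%N) /\
  forall t, performed s t -> dlm_step (s t) (r t.+1) (T t.+1) (s t.+1).

(* When the current center is already a minimizer, it is kept or replaced by
   one that precedes it.  With an empty prec the center is kept; with a strict
   total order this holds if ties are broken by least label. *)
Definition ties_follow (prec : rel V) (s : nat -> 'I_k -> V)
    (r : nat -> V -> 'I_k) (T : nat -> 'I_k -> rel V) : Prop :=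
  forall t i, performed s t ->
    s t i \in minimizers (region (r t.+1) i) (T t.+1 i) ->
    s t.+1 i = s t i \/ prec (s t.+1 i) (s t i).

End DLM.

End Network.

Definition center_set (V : finType) (k : nat) (s : 'I_k -> V) : {set V} :=
  [set s i | i : 'I_k].

(* Main.v *)
Require Import Defs.
From mathcomp Require Import all_boot all_order all_algebra.

(* In a tree, a spanning tree of a region realizes the distances of the whole
   graph, because simple paths are unique.  The potential local_cost s, in which
   each center serves its own demand and every other node is served by a nearest
   center, equals the cost of assigning each node to the center of its Voronoi
   region.  Replacing each center by a minimizer in its region does not raise
   that cost, and neither does reassigning the nodes.  If the potential stays constant, each
   old center was already a minimizer, so by the tie-breaking rule each center
   stays or descends along a strict order; hence a repeated configuration, which
   the pigeonhole principle forces, makes every center stay. *)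

Import Order.TTheory GRing.Theory Num.Theory.
Local Open Scope ring_scope.

(** [rho] and [server] minimize with a default value that may violate the predicate, so existence of
    some candidate is assumed instead of [P i0]. *)
Lemma arg_min_exP (R : realFieldType) (I : finType) (i0 : I) (P : pred I)
    (F : I -> R) :
  (exists i, P i) ->
  P [arg min_(i < i0 | P i) F i]%O /\
  (forall j, P j -> F [arg min_(i < i0 | P i) F i]%O <= F j).
Proof.
case=> i1 Pi1; rewrite /Order.arg_min /extremum.
case: pickP => [i /andP[Pi /forallP Fi] | none] /=.
  by split=> // j Pj; apply: (implyP (Fi j)).
case: (arg_minP F Pi1) => i Pi Fi; have /idP[] := none i => /=.
by rewrite Pi; apply/forallP=> j; apply/implyP/Fi.
Qed.

Lemma last_rev_belast (T : Type) (x : T) (p : seq T) :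
  last (last x p) (rev (belast x p)) = x.
Proof. by case: p => [|y p] //=; rewrite rev_cons last_rcons. Qed.

Lemma mem_zip_fst (S T : eqType) (s : seq S) (t : seq T) x y :
  (x, y) \in zip s t -> x \in s.
Proof.
elim: s t => [|a s IHs] [|b t] //=; rewrite !inE.
by case/orP=> [/eqP[-> _] | /IHs ->]; rewrite ?eqxx ?orbT.
Qed.

(** * Uniqueness of simple paths in an acyclic graph *)

Section SimplePaths.
Context {V : finType} {e : rel V}.
Hypothesis sym : symmetric e.

(* Where two simple paths part, their branches close up to a cycle. *)
Lemma simple_path_uniq (acyclic : forall c, ucycle e c -> (size c <= 2)%N)
    u (p q : seq V) :
  path e u p -> path e u q -> uniq (u :: p) -> uniq (u :: q) ->
  last u p = last u q -> p = q.
Proof.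
elim: p q u => [|a p IHp] [|b q] u //=.
- by move=> _ _ _ /andP[+ _] eq; rewrite {1}eq mem_last.
- by move=> _ _ /andP[+ _] _ eq; rewrite -{1}eq mem_last.
case/andP=> eua pathp /andP[eub pathq] /andP[uap Up] /andP[ubq Uq] eq_last.
have [eqab | neqab] := eqVneq a b.
  by subst b; rewrite (IHp q a).
(* Going from [a] along [p] to the common end and back along [q] to [b] avoids [u]; a simple path
   extracted from this walk closes up with [u]. *)
have pathr : path e a (p ++ rev (belast b q)).
  by rewrite cat_path pathp eq_last rev_path (eq_path (e' := e)).
have lastr : last a (p ++ rev (belast b q)) = b.
  by rewrite last_cat eq_last last_rev_belast.
have unr : u \notin p ++ rev (belast b q).
  rewrite mem_cat negb_or mem_rev; apply/andP; split.
    by apply: contra uap => up; rewrite inE up orbT.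
  by apply: contra ubq => /mem_belast.
move: lastr; case/shortenP: pathr => w pathw Uw subw lastw.
have /acyclic /=: ucycle e [:: u, a & w].
  rewrite /ucycle cons_uniq Uw andbT [cycle _ _]/=.
  rewrite rcons_path eua pathw lastw sym eub inE negb_or /=.
  apply/andP; split; last by apply: contra unr => /subw.
  by apply: contra uap => /eqP->; rewrite mem_head.
by case: w lastw {pathw Uw subw} => // /eqP; rewrite (negPf neqab).
Qed.

End SimplePaths.

(** * Path lengths and shortest-path distances *)

Section Distances.
Context {R : realFieldType} {V : finType} {G : network R V}.
Implicit Types (u v : V) (p : seq V).

Lemma path_len_nil u : path_len G u [::] = 0.
Proof. exact: big_nil. Qed.

Lemma path_len_cons u v p :
  path_len G u (v :: p) = len G u v + path_len G v p.
Proof. exact: big_cons. Qed.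

Lemma path_len_rcons u p v :
  path_len G u (rcons p v) = path_len G u p + len G (last u p) v.
Proof.
elim: p u => [|a p IHp] u /=.
  by rewrite path_len_cons !path_len_nil addr0 add0r.
by rewrite !path_len_cons IHp addrA.
Qed.

Lemma path_len_rev u p :
  path (edge G) u p -> path_len G (last u p) (rev (belast u p)) = path_len G u p.
Proof.
elim: p u => [|a p IHp] u //= /andP[eua pathp].
rewrite rev_cons path_len_rcons IHp // path_len_cons addrC; congr (_ + _).
by rewrite last_rev_belast -(len_sym eua).
Qed.

Lemma path_len_ge0 u p : path (edge G) u p -> 0 <= path_len G u p.
Proof.
elim: p u => [|a p IHp] u /=; first by rewrite path_len_nil.
by case/andP=> eua pathp; rewrite path_len_cons addr_ge0 ?len_ge0 ?IHp.
Qed.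

Lemma path_len_cat u p q :
  path_len G u (p ++ q) = path_len G u p + path_len G (last u p) q.
Proof.
elim: p u => [|a p IHp] u /=; first by rewrite path_len_nil add0r.
by rewrite !path_len_cons IHp addrA.
Qed.

(** Cutting out a loop does not lengthen a path, because edge lengths are non-negative. *)
Lemma simple_path_le u p :
  path (edge G) u p ->
  exists q, [/\ path (edge G) u q, last u q = last u p, uniq (u :: q)
    & path_len G u q <= path_len G u p].
Proof.
elim: p u => [|a p IHp] u /=; first by exists [::].
case/andP=> eua /IHp[q [pathq lastq Uq leq]].
have [uq | unq] := boolP (u \in a :: q); last first.
  exists (a :: q); split; rewrite //= ?eua //; first by rewrite unq.
  by rewrite !path_len_cons lerD2l.
case/splitPl: uq pathq lastq Uq leq => q1 q2 last1.
rewrite cat_path last_cat last1 -cat_cons cat_uniq => /andP[path1 path2] lastq.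
case/and3P=> _ /hasPn disj Uq2 leq; exists q2; split=> //=.
  rewrite Uq2 andbT; apply/negP=> /disj /=.
  by rewrite -last1 mem_last.
rewrite path_len_cons; apply: ler_wpDl; first exact: len_ge0.
by apply: le_trans leq; rewrite path_len_cat last1 lerDr path_len_ge0.
Qed.

Section Rho.
Variable T : rel V.

(** The size bound [#|V|] in [rho] excludes no simple path, since its vertices are distinct. *)
Lemma rhoP u v : connect T u v ->
  [/\ path T u (rho G T u v), last u (rho G T u v) = v,
      uniq (u :: rho G T u v)
    & forall p, path T u p -> last u p = v -> uniq (u :: p) ->
        path_dist G T u v <= path_len G u p].
Proof.
pose P (p : {bseq #|V| of V}) :=
  [&& path T u p, last u p == v & uniq (u :: p)].
have bP p : path T u p -> last u p = v -> uniq (u :: p) ->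
    exists2 b : {bseq #|V| of V}, P b & val b = p.
  move=> pathp lastp Up.
  have szp : (size p <= #|V|)%N.
    by rewrite ltnW // -[_.+1]/(size (u :: p)) -(card_uniqP Up) max_card.
  by exists (Bseq szp) => //; rewrite /P pathp lastp eqxx.
move=> /connectP[p0 pathp0 def_v].
have ex : exists b, P b.
  move: def_v; case/shortenP: pathp0 => p pathp Up _ def_v.
  by have [b Pb _] := bP p pathp (esym def_v) Up; exists b.
have [/and3P[pathr /eqP lastr Ur] min] :=
  arg_min_exP _ _ [bseq] P (fun b : {bseq #|V| of V} => path_len G u b) ex.
split=> // p pathp lastp Up.
by have [b Pb <-] := bP p pathp lastp Up; apply: min.
Qed.

Lemma path_distvv v : path_dist G T v v = 0.
Proof.
have [_ + + _] := rhoP v v (connect0 T v); rewrite /path_dist.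
case: (rho G T v v) => [|a p]; first by rewrite path_len_nil.
by move=> /= eq /andP[+ _]; rewrite -{1}eq mem_last.
Qed.

End Rho.

Local Notation pd := (path_dist G (edge G)).

Lemma path_dist_le u p : path (edge G) u p -> pd u (last u p) <= path_len G u p.
Proof.
move=> pathp; have [q [pathq lastq Uq]] := simple_path_le u p pathp.
apply: le_trans; rewrite -lastq.
have [|_ _ _] := rhoP (edge G) u (last u q); last exact.
by apply/connectP; exists q.
Qed.

Hypothesis conn : forall u v, connect (edge G) u v.

Lemma path_dist_sym u v : pd u v = pd v u.
Proof.
suff le a b : pd a b <= pd b a by apply/le_anti; rewrite !le.
have [pathp lastp _ _] := rhoP (edge G) b a (conn b a).
rewrite {2}/path_dist; move: (rho _ _ b a) pathp lastp => p pathp <-.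
have := path_dist_le (last b p) (rev (belast b p)).
rewrite last_rev_belast path_len_rev // rev_path; apply.
by rewrite (eq_path (e' := edge G)) // => x y; rewrite edge_sym.
Qed.

Lemma path_dist_edge u v c : edge G u v -> pd c v <= pd c u + len G u v.
Proof.
move=> euv; have [pathp lastp _ _] := rhoP (edge G) c u (conn c u).
rewrite -{2}lastp {2}/path_dist -path_len_rcons.
by rewrite -{1}(last_rcons c (rho G (edge G) c u) v) path_dist_le //
  rcons_path pathp lastp.
Qed.

(** A simple path from [v] never returns to [v], so the edge from [v] to [u] is its first one and
    the rest is a path from [u] to [c]. *)
Lemma path_dist_rho_edge u v c :
  (v, u) \in path_edges v (rho G (edge G) v c) ->
  len G v u + pd u c <= pd v c.
Proof.
have [pathp lastp Up _] := rhoP (edge G) v c (conn v c).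
rewrite {2}/path_dist; case: (rho G _ v c) pathp lastp Up => [|a p] //=.
case/andP=> eva pathp lastp /andP[vp _].
rewrite inE => /orP[/eqP[->] | /mem_zip_fst]; last by rewrite (negPf vp).
by rewrite path_len_cons lerD2l -lastp path_dist_le.
Qed.

Lemma dist_in_subtree (T : rel V) u v :
  (forall c, ucycle (edge G) c -> (size c <= 2)%N) ->
  subrel T (edge G) -> connect T u v -> dist_in G T u v = dist G u v.
Proof.
move=> acyclic subT connT; rewrite /dist /dist_in; case: eqP => // _.
have [pT lT uT _] := rhoP T u v connT.
have [pG lG uG _] := rhoP (edge G) u v (conn u v).
rewrite /path_dist; congr path_len.
apply: (simple_path_uniq (@edge_sym _ _ G) acyclic u) => //; last by rewrite lG.
exact: sub_path pT.
Qed.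

End Distances.

(** * Cost functions, Voronoi regions and a single iteration *)

Section Costs.
Context {R : realFieldType} {V : finType} (G : network R V).
Context {k : nat}.
Implicit Types (s : 'I_k -> V) (r : V -> 'I_k) (T : 'I_k -> rel V).

Local Notation pd := (path_dist G (edge G)).

Definition assigned_cost s r : R :=
  \sum_v demand G v * dist G (s (r v)) v.

(* Unlike cost, this never increases along DLM, even without the hypothesis serves_itself. *)
Definition local_cost s : R :=
  \sum_v demand G v *
    (if v \in codom s then loc G v else dist G (server G (center_set s) v) v).

Lemma dist_codom s i v : v \notin codom s -> dist G (s i) v = pd (s i) v.
Proof.
move=> vs; rewrite /dist /dist_in; case: eqP => // eq.
by rewrite -eq codom_f in vs.
Qed.

Lemma server_le (S : {set V}) x v :
  x \in S -> dist G (server G S v) v <= dist G x v.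
Proof.
move=> xS.
by have [|_] := arg_min_exP R V v (mem S) (dist G ^~ v); [exists x | apply].
Qed.

Lemma server_in (S : {set V}) x v : x \in S -> server G S v \in S.
Proof.
move=> xS.
by have [|] := arg_min_exP R V v (mem S) (dist G ^~ v); first by exists x.
Qed.

Lemma mem_center_set s i : s i \in center_set s.
Proof. exact: imset_f. Qed.

Lemma cost_le_local s : cost G (center_set s) <= local_cost s.
Proof.
apply: ler_sum => v _; apply: ler_wpM2l; first exact: demand_ge0.
case: ifP => // /codomP[i ->].
apply: le_trans (server_le _ (s i) _ (mem_center_set s i)) _.
by rewrite /dist /dist_in eqxx.
Qed.

(** A center with a large local cost might be served more cheaply by another center, which would
    push [cost] below [local_cost]; [serves_itself] rules this out. *)
Lemma local_le_cost s :
  serves_itself G (center_set s) -> local_cost s <= cost G (center_set s).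
Proof.
move=> self; apply: ler_sum => v _; apply: ler_wpM2l; first exact: demand_ge0.
case: ifP => // /codomP[i ->].
have := self _ _ (mem_center_set s i) (server_in _ _ (s i) (mem_center_set s i)).
by rewrite {1}/dist /dist_in eqxx.
Qed.

Lemma local_le_assigned s r :
  cancel s r -> local_cost s <= assigned_cost s r.
Proof.
move=> sK; apply: ler_sum => v _; apply: ler_wpM2l; first exact: demand_ge0.
case: ifP => [/codomP[i ->] | _]; last exact/server_le/mem_center_set.
by rewrite sK /dist /dist_in eqxx.
Qed.

(** The rules for nearest and tied nodes exclude generators, so only the first rule can add [s i];
    injectivity then identifies the index. *)
Lemma voronoi_cancel s r : injective s -> voronoi G s r -> cancel s r.
Proof.
move=> inj_s vor i; have := vor (s i); move: {-2}(s i) (erefl (s i)) => v eqv av.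
case: av eqv
  => [j + /inj_s <- | {}v /negP vs _ eqv | {}v u /negP vs _ _ _ _ eqv] //.
- by case: vs; rewrite eqv codom_f.
- by case: vs; rewrite eqv codom_f.
Qed.

(** In the tie case [u] lies on a shortest path from [v] to a nearest center [s i]. The center of
    [u] is no farther from [u] than [s i] is, hence, going through [u], no farther from [v]. *)
Lemma voronoi_nearest s r v :
    (forall u v, connect (edge G) u v) -> injective s -> voronoi G s r ->
  v \notin codom s -> r v \in nearest G s v.
Proof.
move=> conn inj_s vor; elim: (vor v) => {v} [i _ | v _ -> _ | v u].
- by rewrite codom_f.
- exact: set11.
move=> vs _ + _ IHu eq_r _; rewrite inE => /andP[evu /exists_inP[i near_i vu]].
rewrite inE; apply/forallP=> j; rewrite !dist_codom //.
have euv : edge G u v by rewrite edge_sym.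
have le_i : pd (s i) v <= pd (s j) v.
  by move: near_i; rewrite inE => /forallP/(_ j); rewrite !dist_codom.
apply: le_trans le_i; apply: le_trans (path_dist_edge conn _ _ _ euv) _.
rewrite (path_dist_sym conn _ v).
apply: le_trans (path_dist_rho_edge conn _ _ _ vu).
rewrite addrC (len_sym evu) lerD2l eq_r.
(* If [u] is itself a center, the induction hypothesis is void, but then [s (r u)] is [u], at path
   distance 0. *)
have [/codomP[j' def_u] | us] := boolP (u \in codom s).
  rewrite def_u (voronoi_cancel s r) // path_distvv.
  have [pathp _ _ _] := rhoP (G := G) (edge G) (s j') (s i) (conn _ _).
  exact: path_len_ge0.
move: (IHu us); rewrite inE => /forallP/(_ i).
by rewrite !dist_codom // (path_dist_sym conn u).
Qed.

Lemma assigned_le_local s r :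
    (forall u v, connect (edge G) u v) -> injective s -> voronoi G s r ->
  assigned_cost s r <= local_cost s.
Proof.
move=> conn inj_s vor; apply: ler_sum => v _.
apply: ler_wpM2l; first exact: demand_ge0.
case: ifPn => [/codomP[i ->] | vs].
  by rewrite (voronoi_cancel s r) // /dist /dist_in eqxx.
have /imsetP[j _ ->] := server_in _ _ v (mem_center_set s (r v)).
by have := voronoi_nearest s r v conn inj_s vor vs; rewrite inE => /forallP.
Qed.

Hypothesis treeG : is_tree [set: V] (edge G).

Lemma tree_connected u v : connect (edge G) u v.
Proof. by case: treeG => _ _ conn _; apply: conn; rewrite inE. Qed.

Lemma assigned_costE s r T :
  (forall i, spanning_tree G (region r i) (T i)) -> cancel s r ->
  assigned_cost s r = \sum_i tree_cost G (region r i) (T i) (s i).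
Proof.
move=> span sK; have [_ _ _ acyclic] := treeG.
rewrite /assigned_cost (partition_big r predT) //=; apply: eq_bigr => i _.
rewrite /tree_cost; apply: eq_big => [v | v /eqP rv]; first by rewrite inE.
have [[_ _ connT _] subT] := span i.
rewrite rv (dist_in_subtree tree_connected (T i)) //.
by apply: connT; rewrite inE ?sK ?rv.
Qed.

(** [assigned_cost s' r <= assigned_cost s r] lies between the two values of [local_cost]. If these
    do not drop, it is an equality, and a sum of regionwise inequalities is tight only if each of
    them is. *)
Lemma dlm_step_local_cost s r T s' : injective s -> dlm_step G s r T s' ->
  local_cost s' <= local_cost s /\
  (local_cost s <= local_cost s' ->
     forall i, s i \in minimizers G (region r i) (T i)).
Proof.
move=> inj_s [vor mst min].
have sK := voronoi_cancel s r inj_s vor.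
have s'K : cancel s' r by move=> i; have := min i; rewrite !inE => /andP[/eqP].
have span i : spanning_tree G (region r i) (T i) by have [] := mst i.
have tree_le i x : r x = i -> tree_cost G (region r i) (T i) (s' i) <=
    tree_cost G (region r i) (T i) x.
  move=> rx; have := min i; rewrite inE => /andP[_ /forall_inP]; apply.
  by rewrite inE rx.
have leA : assigned_cost s' r <= assigned_cost s r
    ?= iff [forall i, s i \in minimizers G (region r i) (T i)].
  rewrite !(assigned_costE _ r T) //.
  apply: leif_sum => i _.
  split; first exact/tree_le/sK.
  rewrite -[RHS]/(s i \in minimizers G (region r i) (T i)) !inE sK eqxx /=.
  apply/eqP/forall_inP => [<- x | le_s].
    by rewrite inE => /eqP; apply: tree_le.
  apply/le_anti/andP; split; first by rewrite tree_le ?sK.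
  by apply: le_s; rewrite inE s'K.
have le1 := local_le_assigned s' r s'K.
have le2 := assigned_le_local s r tree_connected inj_s vor.
split; first by rewrite (le_trans le1) // (le_trans leA.1).
move=> le_s; apply/forallP; rewrite -leA.2 eq_le leA.1.
exact: le_trans le2 (le_trans le_s le1).
Qed.

End Costs.

Section Runs.
Context {R : realFieldType} {V : finType} {G : network R V}.
Context {k : nat} {eta : R} {maxiter : option nat}.
Context {s : nat -> 'I_k -> V} {r : nat -> V -> 'I_k} {T : nat -> 'I_k -> rel V}.
Hypothesis run : dlm_run G eta maxiter s r T.

(** Each new center lies in its own region, and the regions are disjoint. *)
Lemma performed_inj t : performed G eta maxiter s t -> injective (s t).
Proof.
case: t => [|t] perf; first by case: run.
have perf_t : performed G eta maxiter s t.
  case/andP: perf => within /forallP ns; apply/andP; split.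
    by move: within; rewrite /within_maxiter; case: (maxiter) => // m /ltnW.
  by apply/forallP=> u; apply: (ns (widen_ord (leqnSn t) u)).
have [_ _ min] := run.2 t perf_t.
have s_region i : r t.+1 (s t.+1 i) = i.
  by have := min i; rewrite !inE => /andP[/eqP].
exact: can_inj s_region.
Qed.

End Runs.

Theorem lemma4 (R : realFieldType) (V : finType) (G : network R V)
    (k : nat) (eta : R) (maxiter : option nat)
    (s : nat -> 'I_k -> V) (r : nat -> V -> 'I_k) (T : nat -> 'I_k -> rel V)
    (treeG : is_tree [set: V] (edge G))
    (k_gt0 : (0 < k)%N) (k_lt : (k < #|V|)%N) (eta_gt0 : 0 < eta)
    (run : dlm_run G eta maxiter s r T) :
  (forall t : nat,
     performed G eta maxiter s t ->
     serves_itself G (center_set (s t)) ->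
     cost G (center_set (s t.+1)) <= cost G (center_set (s t)))
  /\
  (forall prec : rel V,
     irreflexive prec -> transitive prec ->
     ties_follow G eta maxiter prec s r T ->
     maxiter = None ->
     exists t : nat, (1 <= t)%N /\ stopped G eta (s t.-1) (s t)).
Proof.
split=> [t perf self | prec irr trans ties noMax].
  have [le_local _] :=
    dlm_step_local_cost G treeG _ _ _ _ (performed_inj run t perf) (run.2 t perf).
  apply: le_trans (cost_le_local _ _) (le_trans le_local _).
  exact: local_le_cost.
(* With [N] possible configurations, one of the first [N.+1] iterations must stop. *)
pose N := #|{ffun 'I_k -> V}|.
have [/existsP[t stop] | /existsPn nstop] :=
  boolP [exists t : 'I_N.+1, stopped G eta (s t) (s t.+1)].
  by exists t.+1.
have perf t : (t <= N)%N -> performed G eta maxiter s t.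
  move=> leN; rewrite /performed noMax /=; apply/forallP => u.
  exact: (nstop (widen_ord (leqW leN) u)).
have step t : (t <= N)%N -> local_cost G (s t.+1) <= local_cost G (s t) /\
    (local_cost G (s t) <= local_cost G (s t.+1) ->
      forall i, s t.+1 i = s t i \/ prec (s t.+1 i) (s t i)).
  move=> leN; have [le_local eq_min] := dlm_step_local_cost G treeG _ _ _ _
    (performed_inj run t (perf t leN)) (run.2 t (perf t leN)).
  by split=> // /eq_min min i; apply: ties (perf t leN) (min i).
have anti a b : (a <= b <= N.+1)%N ->
    local_cost G (s b) <= local_cost G (s a).
  elim: b => [|b IHb]; first by rewrite leqn0 => /andP[/eqP->].
  case/andP; rewrite leq_eqVlt => /orP[/eqP-> // | ltab ltbN].
  apply: le_trans (step b _).1 (IHb _) => //.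
  by rewrite -ltnS ltab ltnW.
(* Configurations are indexed families rather than sets, so a repetition returns every single center
   to its place. *)
pose f (t : 'I_N.+1) : {ffun 'I_k -> V} := [ffun i => s t i].
have [a [b lt_ab eq_ab]] : exists a : 'I_N.+1, exists2 b : 'I_N.+1, (a < b)%N &
    f a = f b.
  have /injectivePn[a [b neq_ab eq_ab]] : ~~ injectiveb f.
    by apply/injectiveP => /leq_card; rewrite card_ord ltnn.
  have [lt_ab|lt_ba|/val_inj eq] := ltngtP a b; last by rewrite eq eqxx in neq_ab.
    by exists a, b.
  by exists b, a.
have {}eq_ab i : s a i = s b i by have /ffunP/(_ i) := eq_ab; rewrite !ffunE.
have eqL : local_cost G (s a) = local_cost G (s b).
  have eqC : codom (s a) = codom (s b) by apply: eq_codom.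
  have eqS : center_set (s a) = center_set (s b) by apply: eq_imset.
  by rewrite /local_cost eqC eqS.
(* The comparison starts at [a.+1], so that a strict first move from [s a i] can be put in front of
   it. *)
have down i c : (a < c <= b)%N -> s c i = s a.+1 i \/ prec (s c i) (s a.+1 i).
  elim: c => // c IHc /andP[].
  rewrite ltnS leq_eqVlt => /orP[/eqP-> | lt_ac] lt_cb.
    by left.
  have leN : (c <= N)%N by rewrite -ltnS (ltn_trans lt_cb).
  (* The potential takes the same value at [a] and [b], so it is constant in between. *)
  have flat : local_cost G (s c) <= local_cost G (s c.+1).
    apply: (@le_trans _ _ (local_cost G (s a))).
      by apply: anti; rewrite ltnW //= leqW.
    by rewrite eqL; apply: anti; rewrite lt_cb ltnW.
  have {}IHc : s c i = s a.+1 i \/ prec (s c i) (s a.+1 i).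
    by apply: IHc; rewrite lt_ac ltnW.
  have [-> // | lt_c] := (step c leN).2 flat i.
  right; case: IHc => [<- // | ]; exact: trans lt_c.
have stay i : s a.+1 i = s a i.
  have flat : local_cost G (s a) <= local_cost G (s a.+1).
    by rewrite eqL; apply: anti; rewrite lt_ab ltnW.
  have leN : (a <= N)%N by rewrite -ltnS.
  have [//|lt_a] := (step a leN).2 flat i.
  (* A strict first move would put [s b i], which is [s a i], strictly below itself. *)
  have [<- | ] := down i b (introT andP (conj lt_ab (leqnn b))); first exact/esym.
  by rewrite -eq_ab => /trans-/(_ _ lt_a); rewrite irr.
(* All displacements from [s a] to [s a.+1] are 0, so the stopping criterion holds there. *)
have /negP[] := nstop a.
by apply/forallP=> i; rewrite stay path_distvv ltW.
Qed.
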